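(* For all integers $n\ge 8$, $$\sqrt{2\pi n}\left(\frac{n}{e}\right)^n e^{\frac{1}{12n}-\frac{1}{360n^3+103n}}\ \ge\ n!\ \ge\ \sqrt{2\pi n}\left(\frac{n}{e}\right)^n e^{\frac{1}{12n}-\frac{1}{360n^3+102n}}.$$
   Context: Here $e$ is the base of the natural logarithm and $n!$ is the usual factorial. *)

(* Defs.v *)
From Stdlib Require Export Reals Factorial.

(* Main.v *)
Require Import Defs.
From Stdlib Require Import Reals Factorial Lra Lia.
From Coquelicot Require Import Coquelicot.
Open Scope R_scope.

(** Write [b n = ln n! - (n + 1/2) ln n + n], so that the claim is a two-sided
    bound on [b n - ln (2 PI) / 2].  With [y = 1 / (2 n + 1)],

      [b n - b (n+1) = (n + 1/2) ln (1 + 1/n) - 1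
                     = y^2/3 + y^4/5 + y^6/7 + ... ].

    If [g] tends to 0 and [g n - g (n+1)] lies below (above) this series for
    every [n >= 1], then [b - g] decreases (increases), so [b n - g n] lies above
    (below) the limit of [b].  The upper bound takes for [g] the function
    [corrected_series 103] of the claim itself ([corrected_series_step]).
    For the lower bound the analogous step inequality for [corrected_series 102]
    is false at [n = 8]; so it is proved, for every [n >= 1], for the Stirling
    series cut after its [n^-7] term
    ([lower_series_step]), which is then compared with [corrected_series 102]
    ([corrected_series_le_lower_series]).  The expansion
    [1/(360 n^3 + c n) = 1/(360 n^3) - c/(129600 n^5) + ...] explains the two
    constants: matching the term [1/(1260 n^5)] of Stirling's series needs
    [c = 720/7], which lies between 102 and 103.

    The limit of [b] comes from Wallis' integrals, which evaluate
    [2 b n - b (2 n)] up to [1/(4 n)] ([doubling_bounds]); the two step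
    inequalities give [b n - b (2 n) = O(1/n)], and the difference of these
    quantities is [b n], so the limit is [ln (2 PI) / 2] with error at most
    [1/n] ([stirling_remainder_near_limit]). *)

(** * The logarithm of (1 + y) / (1 - y) *)

Lemma nonneg_derivative_le (f f' : R -> R) (y : R) :
  0 < y ->
  (forall t, 0 <= t <= y -> is_derive f t (f' t)) ->
  (forall t, 0 <= t <= y -> 0 <= f' t) ->
  f 0 <= f y.
Proof.
  intros hy hd hpos.
  destruct (MVT_cor2 f f' 0 y hy) as [c [hc [h0 h1]]].
  { intros t ht. apply is_derive_Reals, hd, ht. }
  assert (0 <= f' c * (y - 0)) by (apply Rmult_le_pos; [apply hpos|]; lra).
  lra.
Qed.

(** Partial sum of the series of [2 artanh y]: the derivatives of the two sides
    differ by the tail [2 y^10 / (1 - y^2)] of a geometric series. *)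
Lemma log_ratio_lower (y : R) :
  0 < y < 1 ->
  2 * (y + y ^ 3 / 3 + y ^ 5 / 5 + y ^ 7 / 7 + y ^ 9 / 9)
    <= ln (1 + y) - ln (1 - y).
Proof.
  intros [hy0 hy1].
  pose (f := fun t => ln (1 + t) - ln (1 - t)
                      - 2 * (t + t ^ 3 / 3 + t ^ 5 / 5 + t ^ 7 / 7 + t ^ 9 / 9)).
  cut (f 0 <= f y).
  { unfold f. rewrite Rplus_0_r, Rminus_0_r, ln_1. lra. }
  apply (nonneg_derivative_le f (fun t => 2 * t ^ 10 / (1 - t ^ 2))); [exact hy0| |].
  - intros t ht. unfold f. assert (1 - t ^ 2 <> 0) by nra.
    auto_derive; [repeat split; lra|]. field. repeat split; nra.
  - intros t ht. apply Rcomplements.Rdiv_le_0_compat; [|nra].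
    assert (0 <= t ^ 10) by (apply pow_le; lra). lra.
Qed.

(** The tail [y^7/7 + y^9/9 + ...] is majorized by a geometric series with all
    denominators replaced by 7. *)
Lemma log_ratio_upper (y : R) :
  0 < y < 1 ->
  ln (1 + y) - ln (1 - y)
    <= 2 * (y + y ^ 3 / 3 + y ^ 5 / 5 + y ^ 7 / (7 * (1 - y ^ 2))).
Proof.
  intros [hy0 hy1].
  pose (f := fun t => 2 * (t + t ^ 3 / 3 + t ^ 5 / 5 + t ^ 7 / (7 * (1 - t ^ 2)))
                      - (ln (1 + t) - ln (1 - t))).
  cut (f 0 <= f y).
  { unfold f. rewrite Rplus_0_r, Rminus_0_r, ln_1. lra. }
  apply (nonneg_derivative_le f (fun t => 4 / 7 * t ^ 8 / (1 - t ^ 2) ^ 2)); [exact hy0| |].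
  - intros t ht. unfold f. assert (1 - t ^ 2 <> 0) by nra.
    auto_derive; [repeat split; try lra; nra|]. field. repeat split; nra.
  - intros t ht. apply Rcomplements.Rdiv_le_0_compat; [|apply pow_lt; nra].
    assert (0 <= t ^ 8) by (apply pow_le; lra). lra.
Qed.

(** * Decrements of the logarithmic remainder *)

Definition stirling_remainder (n : nat) : R :=
  ln (INR (fact n)) - (INR n + 1 / 2) * ln (INR n) + INR n.

(** The substitution [1 + 1/n = (1 + y) / (1 - y)], for which
    [n + 1/2 = 1 / (2 y)], makes the expansion even in [y]. *)
Lemma stirling_remainder_step (n : nat) :
  (1 <= n)%nat ->
  let y := 1 / (2 * INR n + 1) in
  stirling_remainder n - stirling_remainder (S n)
    = (ln (1 + y) - ln (1 - y)) / (2 * y) - 1.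
Proof.
  intros hn y. unfold stirling_remainder.
  assert (hn1 : 1 <= INR n) by (apply (le_INR 1), hn).
  rewrite fact_simpl, mult_INR, S_INR.
  rewrite ln_mult; [|lra|apply lt_0_INR, lt_O_fact].
  replace (1 + y) with ((INR n + 1) * (2 * y)) by (unfold y; field; lra).
  replace (1 - y) with (INR n * (2 * y)) by (unfold y; field; lra).
  assert (hy : 0 < y) by (apply Rdiv_lt_0_compat; lra).
  rewrite !(ln_mult _ (2 * y)) by lra.
  unfold y. field. lra.
Qed.

(** The asymptotic series of [ln n! - ln (sqrt (2 PI n) (n/e)^n)], cut after
    four terms. *)
Definition lower_series (x : R) : R :=
  1 / (12 * x) - 1 / (360 * x ^ 3) + 1 / (1260 * x ^ 5) - 1 / (1680 * x ^ 7).

(** The exponent in the claim; [c] mimics the terms of Stirling's series beyond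
    [1/(360 x^3)]. *)
Definition corrected_series (c x : R) : R :=
  1 / (12 * x) - 1 / (360 * x ^ 3 + c * x).

(** As [lower_series] is odd, its decrement from [x] to [x + 1] is invariant
    under [x -> - x - 1], hence a rational function of [v = x (x + 1)]; and
    [y^2 = 1 / (4 v + 1)].  In [v] the inequality amounts to the positivity of a
    polynomial all of whose coefficients are positive.  The sum must include
    [y^8/9]: without it the polynomial has a negative leading coefficient. *)
Lemma lower_series_step (n : nat) :
  (1 <= n)%nat ->
  lower_series (INR n) - lower_series (INR (S n))
    <= stirling_remainder n - stirling_remainder (S n).
Proof.
  intros hn. rewrite stirling_remainder_step by exact hn. rewrite S_INR.
  assert (hx : 1 <= INR n) by (apply (le_INR 1), hn).
  set (x := INR n) in *. set (y := 1 / (2 * x + 1)).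
  assert (hy0 : 0 < y) by (apply Rdiv_lt_0_compat; lra).
  assert (hy1 : y < 1) by (apply Rlt_div_l; lra).
  apply Rle_trans with (y ^ 2 / 3 + y ^ 4 / 5 + y ^ 6 / 7 + y ^ 8 / 9).
  2:{ cut (1 + (y ^ 2 / 3 + y ^ 4 / 5 + y ^ 6 / 7 + y ^ 8 / 9)
           <= (ln (1 + y) - ln (1 - y)) / (2 * y)); [lra|].
      apply Rle_div_r; [lra|].
      pose proof (log_ratio_lower y (conj hy0 hy1)). lra. }
  set (v := x * (x + 1)). assert (hv : 0 < v) by (apply Rmult_lt_0_compat; lra).
  assert (E : y ^ 2 / 3 + y ^ 4 / 5 + y ^ 6 / 7 + y ^ 8 / 9
              - (lower_series x - lower_series (x + 1))
            = (3 + 69 * v + 662 * v ^ 2 + 3393 * v ^ 3 + 9802 * v ^ 4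
               + 15146 * v ^ 5 + 9660 * v ^ 6)
              / (5040 * v ^ 7 * (4 * v + 1) ^ 4)).
  { unfold y, v, lower_series. field. repeat split; nra. }
  apply Rminus_le_0. rewrite E.
  apply Rlt_le, Rdiv_lt_0_compat.
  - repeat apply Rplus_lt_0_compat; try apply Rmult_lt_0_compat; try apply pow_lt; lra.
  - repeat apply Rmult_lt_0_compat; try apply pow_lt; lra.
Qed.

(** The same reduction to [v = x (x + 1)]; three terms suffice because
    [corrected_series 103] exceeds Stirling's series already at order [x^-5]. *)
Lemma corrected_series_step (n : nat) :
  (1 <= n)%nat ->
  stirling_remainder n - stirling_remainder (S n)
    <= corrected_series 103 (INR n) - corrected_series 103 (INR (S n)).
Proof.
  intros hn. rewrite stirling_remainder_step by exact hn. rewrite S_INR.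
  assert (hx : 1 <= INR n) by (apply (le_INR 1), hn).
  set (x := INR n) in *. set (y := 1 / (2 * x + 1)).
  assert (hy0 : 0 < y) by (apply Rdiv_lt_0_compat; lra).
  assert (hy1 : y < 1) by (apply Rlt_div_l; lra).
  apply Rle_trans with (y ^ 2 / 3 + y ^ 4 / 5 + y ^ 6 / (7 * (1 - y ^ 2))).
  { cut ((ln (1 + y) - ln (1 - y)) / (2 * y)
         <= 1 + (y ^ 2 / 3 + y ^ 4 / 5 + y ^ 6 / (7 * (1 - y ^ 2)))); [lra|].
    apply Rle_div_l; [lra|].
    pose proof (log_ratio_upper y (conj hy0 hy1)) as h.
    eapply Rle_trans; [exact h|]. right. field. nra. }
  set (v := x * (x + 1)). assert (hv : 0 < v) by (apply Rmult_lt_0_compat; lra).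
  assert (E : corrected_series 103 x - corrected_series 103 (x + 1)
              - (y ^ 2 / 3 + y ^ 4 / 5 + y ^ 6 / (7 * (1 - y ^ 2)))
            = (189830 + 536126 * v + 1200 * v ^ 2)
              / (105 * v * (4 * v + 1) ^ 2
                 * (129600 * v ^ 2 + 74160 * v + 47689))).
  { replace (1 - y ^ 2) with (4 * v * y ^ 2) by (unfold y, v; field; lra).
    unfold y, v, corrected_series. field. repeat split; nra. }
  apply Rminus_le_0. rewrite E.
  apply Rlt_le, Rdiv_lt_0_compat; [nra|].
  repeat apply Rmult_lt_0_compat; try apply pow_lt; nra.
Qed.

(** In [x^2 - 64] the numerator of the difference has positive coefficients;
    its larger root in [x^2] is about 56.5, so that 8 is the first integer for
    which the comparison holds. *)
Lemma corrected_series_le_lower_series (x : R) :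
  8 <= x -> corrected_series 102 x <= lower_series x.
Proof.
  intros hx. set (q := x ^ 2 - 64).
  assert (hq : 0 <= q) by (unfold q; nra).
  assert (E : lower_series x - corrected_series 102 x
            = (139 / 120 + 6 / 35 * q + 1 / 420 * q ^ 2)
              / (x ^ 7 * (360 * x ^ 2 + 102))).
  { unfold q, lower_series, corrected_series. field. repeat split; nra. }
  apply Rminus_le_0. rewrite E.
  apply Rlt_le, Rdiv_lt_0_compat; [nra|].
  apply Rmult_lt_0_compat; [apply pow_lt; lra|nra].
Qed.

(** * Wallis' integrals *)

Definition wallis (n : nat) : R := RInt (fun x => sin x ^ n) 0 (PI / 2).

Lemma ex_RInt_sin_pow (n : nat) (a b : R) : ex_RInt (fun x => sin x ^ n) a b.
Proof.
  apply (@ex_RInt_continuous R_CompleteNormedModule). intros x _.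
  apply (@ex_derive_continuous _ R_NormedModule). auto_derive; trivial.
Qed.

Lemma wallis_0 : wallis 0 = PI / 2.
Proof.
  unfold wallis. simpl. rewrite RInt_const.
  unfold scal; simpl; unfold mult; simpl. ring.
Qed.

Lemma wallis_1 : wallis 1 = 1.
Proof.
  unfold wallis. apply is_RInt_unique.
  replace 1 with (minus (- cos (PI / 2)) (- cos 0)).
  2:{ unfold minus, plus, opp; simpl. rewrite cos_PI2, cos_0. ring. }
  apply (is_RInt_derive (fun x => - cos x)).
  - intros x _. auto_derive; [trivial|]. simpl. ring.
  - intros x _. apply (@ex_derive_continuous _ R_NormedModule). auto_derive; trivial.
Qed.

(** Integration by parts: [- cos x * sin x ^ (n+1)] vanishes at both ends, and
    its derivative is [(n+2) sin^(n+2) - (n+1) sin^n]. *)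
Lemma wallis_rec (n : nat) :
  (INR n + 2) * wallis (S (S n)) = (INR n + 1) * wallis n.
Proof.
  assert (H : is_RInt (fun x => (INR n + 2) * sin x ^ S (S n)
                                - (INR n + 1) * sin x ^ n) 0 (PI / 2) 0).
  { replace 0 with (minus (- cos (PI / 2) * sin (PI / 2) ^ S n)
                          (- cos 0 * sin 0 ^ S n)) at 2.
    2:{ unfold minus, plus, opp; simpl. rewrite cos_PI2, sin_0. ring. }
    apply (is_RInt_derive (fun x => - cos x * sin x ^ S n)).
    - intros x _. auto_derive; [trivial|].
      (* [auto_derive] leaves the exponent [S n] of the power rule as an
         unfolded [INR (S n)]. *)
      change (match n with 0%nat => 1 | S _ => INR n + 1 end) with (INR (S n)).
      rewrite S_INR. pose proof (sin2_cos2 x) as h. unfold Rsqr in h.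
      transitivity (sin x * sin x * sin x ^ n
                    - (INR n + 1) * (cos x * cos x) * sin x ^ n); [ring|].
      replace (cos x * cos x) with (1 - sin x * sin x) by lra. simpl. ring.
    - intros x _. apply (@ex_derive_continuous _ R_NormedModule). auto_derive; trivial. }
  assert (hW : forall (k : nat) (a : R),
             is_RInt (fun x => a * sin x ^ k) 0 (PI / 2) (a * wallis k)).
  { intros k a. apply (is_RInt_scal (V := R_NormedModule)).
    apply (RInt_correct (V := R_CompleteNormedModule)), ex_RInt_sin_pow. }
  pose proof (is_RInt_minus (V := R_NormedModule) _ _ _ _ _ _
                (hW (S (S n)) (INR n + 2)) (hW n (INR n + 1))) as H'.
  apply Rminus_diag_uniq.
  transitivity (RInt (V := R_CompleteNormedModule)
                  (fun x => (INR n + 2) * sin x ^ S (S n) - (INR n + 1) * sin x ^ n)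
                  0 (PI / 2)).
  - symmetry. exact (is_RInt_unique (V := R_CompleteNormedModule) _ _ _ _ H').
  - exact (is_RInt_unique (V := R_CompleteNormedModule) _ _ _ _ H).
Qed.

Lemma wallis_decr (n : nat) : wallis (S n) <= wallis n.
Proof.
  pose proof PI_RGT_0.
  apply RInt_le; [lra|apply ex_RInt_sin_pow|apply ex_RInt_sin_pow|].
  intros x hx. assert (0 <= sin x) by (apply sin_ge_0; lra).
  pose proof (SIN_bound x). pose proof (pow_le (sin x) n ltac:(lra)).
  simpl. nra.
Qed.

(** By the recurrence the left-hand side does not depend on [n]. *)
Lemma wallis_consecutive (n : nat) :
  (INR n + 1) * (wallis n * wallis (S n)) = PI / 2.
Proof.
  induction n as [|n IH].
  - rewrite wallis_0, wallis_1. simpl. ring.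
  - rewrite <- IH, S_INR. pose proof (wallis_rec n) as h.
    transitivity (wallis (S n) * ((INR n + 2) * wallis (S (S n)))); [ring|].
    rewrite h. ring.
Qed.

Lemma wallis_even (n : nat) :
  wallis (2 * n) * (4 ^ n * INR (fact n) ^ 2) = PI / 2 * INR (fact (2 * n)).
Proof.
  induction n as [|n IH].
  - simpl. rewrite wallis_0. ring.
  - replace (2 * S n)%nat with (S (S (2 * n))) by lia.
    pose proof (wallis_rec (2 * n)) as h.
    rewrite !fact_simpl, !mult_INR, !S_INR.
    rewrite mult_INR in h |- *. change (INR 2) with 2 in *.
    set (W := wallis (S (S (2 * n)))) in *.
    transitivity ((2 * (INR n + 1)) * ((2 * INR n + 2) * W) * (4 ^ n * INR (fact n) ^ 2)).
    { simpl. ring. }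
    rewrite h.
    transitivity (2 * (INR n + 1) * (2 * INR n + 1) * (wallis (2 * n) * (4 ^ n * INR (fact n) ^ 2))); [ring|].
    rewrite IH. ring.
Qed.

Lemma wallis_even_pos (n : nat) : 0 < wallis (2 * n).
Proof.
  pose proof PI_RGT_0. pose proof (wallis_even n) as h.
  assert (0 < 4 ^ n * INR (fact n) ^ 2).
  { apply Rmult_lt_0_compat; apply pow_lt; [lra|apply lt_0_INR, lt_O_fact]. }
  assert (0 < PI / 2 * INR (fact (2 * n))).
  { apply Rmult_lt_0_compat; [lra|apply lt_0_INR, lt_O_fact]. }
  nra.
Qed.

(** The square lies between the products of consecutive integrals, by
    monotonicity, and these products are known exactly. *)
Lemma wallis_even_bounds (n : nat) :
  (1 <= n)%nat ->
  2 * INR n * wallis (2 * n) ^ 2 <= PI / 2 <= (2 * INR n + 1) * wallis (2 * n) ^ 2.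
Proof.
  intros hn. pose proof (wallis_even_pos n) as hp.
  assert (hn1 : 1 <= INR n) by (apply (le_INR 1), hn).
  split.
  - pose proof (wallis_consecutive (2 * n - 1)) as h.
    pose proof (wallis_decr (2 * n - 1)) as hd.
    replace (S (2 * n - 1)) with (2 * n)%nat in * by lia.
    rewrite <- h, minus_INR, mult_INR by lia. change (INR 2) with 2; change (INR 1) with 1.
    replace (2 * INR n - 1 + 1) with (2 * INR n) by ring.
    apply Rmult_le_compat_l; [lra|nra].
  - rewrite <- (wallis_consecutive (2 * n)), mult_INR. change (INR 2) with 2.
    pose proof (wallis_decr (2 * n)) as hd.
    apply Rmult_le_compat_l; [lra|].
    rewrite <- Rsqr_pow2. apply Rmult_le_compat_l; lra.
Qed.

(** * The limit of the remainder *)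

(** In [2 b n - b (2 n)] the factorials form the central binomial coefficient,
    which [wallis (2 n)] evaluates, and the multiples of [n] and [n ln n]
    cancel. *)
Lemma doubling_difference_wallis (n : nat) :
  (1 <= n)%nat ->
  2 * stirling_remainder n - stirling_remainder (2 * n)
    = ln (PI / 2) + ln 2 / 2 - ln (wallis (2 * n)) - ln (INR n) / 2.
Proof.
  intros hn. pose proof PI_RGT_0.
  assert (hn1 : 1 <= INR n) by (apply (le_INR 1), hn).
  assert (hf : forall m, 0 < INR (fact m)) by (intros; apply lt_0_INR, lt_O_fact).
  pose proof (f_equal ln (wallis_even n)) as h.
  rewrite ln_mult in h.
  2: apply wallis_even_pos.
  2: apply Rmult_lt_0_compat; apply pow_lt; [lra|apply hf].
  rewrite ln_mult in h by (apply pow_lt; first [lra|apply hf]).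
  rewrite (ln_mult (PI / 2)) in h by (first [lra|apply hf]).
  rewrite !ln_pow in h by (first [lra|apply hf]).
  replace (ln 4) with (2 * ln 2) in h
    by (replace 4 with (2 * 2) by ring; rewrite ln_mult by lra; ring).
  unfold stirling_remainder. rewrite (mult_INR 2 n).
  change (INR 2) with 2 in *. rewrite ln_mult by lra. lra.
Qed.

Lemma doubling_bounds (n : nat) :
  (1 <= n)%nat ->
  ln (2 * PI) / 2 <= 2 * stirling_remainder n - stirling_remainder (2 * n)
    <= ln (2 * PI) / 2 + 1 / (4 * INR n).
Proof.
  intros hn. rewrite doubling_difference_wallis by exact hn.
  pose proof PI_RGT_0. pose proof (wallis_even_pos n) as hp.
  assert (hn1 : 1 <= INR n) by (apply (le_INR 1), hn).
  destruct (wallis_even_bounds n hn) as [hl hu].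
  assert (hw2 : 0 < wallis (2 * n) ^ 2) by (apply pow_lt, hp).
  apply ln_le in hl; [|nra].
  apply ln_le in hu; [|lra].
  rewrite ln_mult, (ln_mult 2), ln_pow in hl by lra.
  rewrite ln_mult, ln_pow in hu by lra.
  change (INR 2) with 2 in *.
  assert (hpi : ln (PI / 2) = ln PI - ln 2) by (apply ln_div; lra).
  rewrite (ln_mult 2 PI) by lra.
  assert (hs : ln (2 * INR n + 1) <= ln 2 + ln (INR n) + 1 / (2 * INR n)).
  { replace (2 * INR n + 1) with (2 * INR n * (1 + 1 / (2 * INR n))) by (field; lra).
    assert (hq : 0 < 1 / (2 * INR n)) by (apply Rdiv_lt_0_compat; lra).
    rewrite ln_mult, (ln_mult 2) by lra.
    pose proof (exp_ineq1 (1 / (2 * INR n)) ltac:(lra)) as he.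
    apply Rlt_le, ln_le in he; [|lra]. rewrite ln_exp in he. lra. }
  replace (1 / (4 * INR n)) with (1 / (2 * INR n) / 2) by (field; lra).
  split; lra.
Qed.

(** Passage to the limit [m -> oo], in the form in which it closes the
    telescoping arguments. *)
Lemma le_of_sub_inv_le (a b : R) (n : nat) :
  (forall m, (n <= m)%nat -> (1 <= m)%nat -> a - 2 / INR m <= b) -> a <= b.
Proof.
  intros h. apply Rnot_lt_le. intros hlt.
  destruct (INR_unbounded (2 / (a - b))) as [m hm].
  assert (hd : 0 < 2 / (a - b)) by (apply Rdiv_lt_0_compat; lra).
  specialize (h (S (m + n)) ltac:(lia) ltac:(lia)).
  assert (hle : INR m <= INR (S (m + n))) by (apply le_INR; lia).
  set (x := INR (S (m + n))) in *.
  assert (hx : 2 / (a - b) < x) by lra.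
  apply Rlt_div_l in hx; [|lra].
  assert (2 / x < a - b) by (apply Rlt_div_l; lra).
  lra.
Qed.

Lemma lower_series_bounds (x : R) : 1 <= x -> 0 <= lower_series x <= 1 / (12 * x).
Proof.
  intros hx. set (z := / x).
  assert (hz : 0 < z <= 1).
  { unfold z. split; [apply Rinv_0_lt_compat; lra|].
    rewrite <- Rinv_1. apply Rinv_le_contravar; lra. }
  replace (lower_series x)
    with (z / 12 - z ^ 3 / 360 + z ^ 5 / 1260 - z ^ 7 / 1680)
    by (unfold lower_series, z; field; lra).
  replace (1 / (12 * x)) with (z / 12) by (unfold z; field; lra).
  assert (hstep : forall k, 0 <= z ^ S (S k) <= z ^ k).
  { intros k. assert (0 <= z ^ k) by (apply pow_le; lra).
    assert (0 <= z * z <= 1) by nra. simpl. nra. }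
  pose proof (hstep 1%nat) as h3. pose proof (hstep 3%nat) as h5.
  pose proof (hstep 5%nat) as h7. rewrite pow_1 in h3. lra.
Qed.

Lemma corrected_series_bounds (c x : R) :
  12 <= c -> 1 <= x -> 0 <= corrected_series c x <= 1 / (12 * x).
Proof.
  intros hc hx. unfold corrected_series.
  assert (hx3 : 0 < x ^ 3) by (apply pow_lt; lra).
  assert (0 < 1 / (360 * x ^ 3 + c * x)) by (apply Rdiv_lt_0_compat; nra).
  assert (1 / (360 * x ^ 3 + c * x) <= 1 / (12 * x)).
  { unfold Rdiv. rewrite !Rmult_1_l. apply Rinv_le_contravar; nra. }
  lra.
Qed.

Lemma antitone_of_step (u : nat -> R) :
  (forall n, (1 <= n)%nat -> u (S n) <= u n) ->
  forall n m, (1 <= n)%nat -> (n <= m)%nat -> u m <= u n.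
Proof.
  intros h n m hn hm. induction hm as [|m hm IH]; [lra|].
  apply Rle_trans with (u m); [apply h; lia|exact IH].
Qed.

Lemma lower_series_telescope (n m : nat) :
  (1 <= n)%nat -> (n <= m)%nat ->
  lower_series (INR n) - lower_series (INR m)
    <= stirling_remainder n - stirling_remainder m.
Proof.
  intros hn hm.
  enough (stirling_remainder m - lower_series (INR m)
          <= stirling_remainder n - lower_series (INR n)) by lra.
  apply (antitone_of_step (fun k => stirling_remainder k - lower_series (INR k)));
    [|exact hn|exact hm].
  intros k hk. pose proof (lower_series_step k hk). lra.
Qed.

Lemma corrected_series_telescope (n m : nat) :
  (1 <= n)%nat -> (n <= m)%nat ->
  stirling_remainder n - stirling_remainder m
    <= corrected_series 103 (INR n) - corrected_series 103 (INR m).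
Proof.
  intros hn hm.
  enough (corrected_series 103 (INR m) - stirling_remainder m
          <= corrected_series 103 (INR n) - stirling_remainder n) by lra.
  apply (antitone_of_step (fun k => corrected_series 103 (INR k) - stirling_remainder k));
    [|exact hn|exact hm].
  intros k hk. pose proof (corrected_series_step k hk). lra.
Qed.

(** [b n] is the difference of [2 b n - b (2 n)] and [b n - b (2 n)]; the first
    is near the limit and the second is small. *)
Lemma stirling_remainder_near_limit (n : nat) :
  (1 <= n)%nat ->
  ln (2 * PI) / 2 - 1 / INR n <= stirling_remainder n <= ln (2 * PI) / 2 + 1 / INR n.
Proof.
  intros hn.
  assert (hn1 : 1 <= INR n) by (apply (le_INR 1), hn).
  assert (hz : 0 < 1 / INR n) by (apply Rdiv_lt_0_compat; lra).
  assert (e2 : INR (2 * n) = 2 * INR n) by (rewrite mult_INR; reflexivity).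
  pose proof (doubling_bounds n hn) as hd.
  pose proof (lower_series_telescope n (2 * n) hn ltac:(lia)) as hl.
  pose proof (corrected_series_telescope n (2 * n) hn ltac:(lia)) as hu.
  rewrite e2 in hl, hu.
  pose proof (lower_series_bounds (INR n) hn1).
  pose proof (lower_series_bounds (2 * INR n) ltac:(lra)).
  pose proof (corrected_series_bounds 103 (INR n) ltac:(lra) hn1).
  pose proof (corrected_series_bounds 103 (2 * INR n) ltac:(lra) ltac:(lra)).
  replace (1 / (4 * INR n)) with (1 / INR n / 4) in * by (field; lra).
  replace (1 / (12 * INR n)) with (1 / INR n / 12) in * by (field; lra).
  replace (1 / (12 * (2 * INR n))) with (1 / INR n / 24) in * by (field; lra).
  lra.
Qed.

(** * Explicit bounds *)

(** [b n - b m] is bounded for all [m >= n] by telescoping; let [m] grow. *)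
Lemma stirling_remainder_lower (n : nat) :
  (1 <= n)%nat ->
  ln (2 * PI) / 2 + lower_series (INR n) <= stirling_remainder n.
Proof.
  intros hn. apply (le_of_sub_inv_le _ _ n). intros m hm hm1.
  assert (hx : 1 <= INR m) by (apply (le_INR 1), hm1).
  assert (0 < 1 / INR m) by (apply Rdiv_lt_0_compat; lra).
  pose proof (lower_series_telescope n m hn hm).
  pose proof (stirling_remainder_near_limit m hm1).
  pose proof (lower_series_bounds (INR m) hx) as hb.
  replace (1 / (12 * INR m)) with (1 / INR m / 12) in hb by (field; lra).
  replace (2 / INR m) with (2 * (1 / INR m)) by (field; lra).
  lra.
Qed.

Lemma stirling_remainder_upper (n : nat) :
  (1 <= n)%nat ->
  stirling_remainder n <= ln (2 * PI) / 2 + corrected_series 103 (INR n).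
Proof.
  intros hn. apply (le_of_sub_inv_le _ _ n). intros m hm hm1.
  assert (hx : 1 <= INR m) by (apply (le_INR 1), hm1).
  assert (0 < 1 / INR m) by (apply Rdiv_lt_0_compat; lra).
  pose proof (corrected_series_telescope n m hn hm).
  pose proof (stirling_remainder_near_limit m hm1).
  pose proof (corrected_series_bounds 103 (INR m) ltac:(lra) hx).
  replace (2 / INR m) with (2 * (1 / INR m)) by (field; lra).
  lra.
Qed.

Lemma stirling_prefactor (n : nat) :
  (1 <= n)%nat ->
  sqrt (2 * PI * INR n) * (INR n / exp 1) ^ n
    = exp (ln (2 * PI) / 2 + ((INR n + 1 / 2) * ln (INR n) - INR n)).
Proof.
  intros hn. pose proof PI_RGT_0. pose proof (exp_pos 1).
  assert (hn1 : 1 <= INR n) by (apply (le_INR 1), hn).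
  assert (hq : 0 < INR n / exp 1) by (apply Rdiv_lt_0_compat; lra).
  assert (hpn : 0 < 2 * PI * INR n) by nra.
  rewrite <- (exp_ln ((INR n / exp 1) ^ n)) by (apply pow_lt, hq).
  rewrite ln_pow, ln_div, ln_exp by lra.
  rewrite <- Rpower_sqrt by exact hpn. unfold Rpower.
  rewrite <- exp_plus, ln_mult by lra.
  f_equal. field.
Qed.

Lemma fact_eq_exp_stirling_remainder (n : nat) :
  INR (fact n)
    = exp (stirling_remainder n + ((INR n + 1 / 2) * ln (INR n) - INR n)).
Proof.
  rewrite <- (exp_ln (INR (fact n))) by (apply lt_0_INR, lt_O_fact).
  f_equal. unfold stirling_remainder. ring.
Qed.

Theorem mainTheorem1 (n : nat) (hn : (8 <= n)%nat) :
  sqrt (2 * PI * INR n) * (INR n / exp 1) ^ n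
    * exp (1 / (12 * INR n) - 1 / (360 * INR n ^ 3 + 103 * INR n))
  >= INR (fact n)
  /\
  INR (fact n)
  >= sqrt (2 * PI * INR n) * (INR n / exp 1) ^ n
    * exp (1 / (12 * INR n) - 1 / (360 * INR n ^ 3 + 102 * INR n)).
Proof.
  assert (hn1 : (1 <= n)%nat) by lia.
  assert (hx : 8 <= INR n) by (apply le_INR in hn; simpl in hn; lra).
  rewrite stirling_prefactor, fact_eq_exp_stirling_remainder by exact hn1.
  rewrite <- !exp_plus.
  fold (corrected_series 103 (INR n)) (corrected_series 102 (INR n)).
  pose proof (stirling_remainder_lower n hn1).
  pose proof (stirling_remainder_upper n hn1).
  pose proof (corrected_series_le_lower_series (INR n) hx).
  assert (hexp : forall a b, a <= b -> exp a <= exp b).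
  { intros a b [h | ->]; [left; apply exp_increasing, h | right; reflexivity]. }
  split; apply Rle_ge, hexp; lra.
Qed.
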